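(* Let $K$ be a field of characteristic zero. A connected graph $\Gamma$ can be reconstructed from its full local ring $K\Gamma$ except when $K\Gamma\cong\mathcal{R}_3$. That is, if $\Gamma$ and $\Gamma'$ are connected graphs whose full local rings $K\Gamma$ and $K\Gamma'$ are isomorphic, then $\Gamma$ and $\Gamma'$ are isomorphic, except for the case in which one of them is the triangle and the other is the three-pointed star (for both of which the full local ring is isomorphic to $\mathcal{R}_3$).
   Context: All graphs are finite and undirected, with any two vertices joined by at most one edge and with no edge going from a vertex to itself. For a graph $\Gamma$ with set of edges $E$, let $K[E]$ be the commutative polynomial ring over $K$ with the edges as variables, and let $I$ be the ideal generated by all products $e_1e_2$ with $e_1,e_2\in E$ having a common vertex (in particular all squares $e^2$). The full local ring of $\Gamma$ is the $K$-algebra $K\Gamma=K[E]/I$; isomorphisms are isomorphisms of $K$-algebras. $\mathcal{R}_3$ is the ring generated over $K$ by three variables all of whose squares and products vanish, i.e. $\mathcal{R}_3=K[x,y,z]/(x^2,y^2,z^2,xy,yz,xz)$. The triangle is the complete graph on three vertices; the three-pointed star is the graph with four vertices and three edges, all three edges meeting one common vertex. *)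

(* Defs.v *)
From HB Require Import structures.
From mathcomp Require Import all_boot all_algebra generic_quotient ring_quotient.
From mathcomp Require Import boolp mpoly.

Set Implicit Arguments.
Unset Strict Implicit.
Unset Printing Implicit Defensive.

Import GRing.Theory.
Local Open Scope ring_scope.
Local Open Scope quotient_scope.

Record sgraph := SGraph {
  vertex :> finType;
  adj : rel vertex;
  adj_sym : ssrbool.symmetric adj;
  adj_irrefl : irreflexive adj }.

Definition edges (G : sgraph) : {set {set G}} :=
  [set e | [exists x, exists y, adj x y && (e == [set x; y])]].

(* The graph without vertices is not connected: it would have the same full
   local ring as the one-vertex graph. *)
Definition connected (G : sgraph) : Prop :=
  (0 < #|G|)%N /\ forall x y : G, connect (@adj G) x y.

Definition graph_iso (G H : sgraph) : Prop :=
  exists2 f : G -> H, bijective f & {mono f : x y / adj x y}.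

Fact triangle_adj_sym : ssrbool.symmetric (fun x y : 'I_3 => x != y).
Proof. by move=> x y; rewrite eq_sym. Qed.

Fact triangle_adj_irrefl : irreflexive (fun x y : 'I_3 => x != y).
Proof. by move=> x; rewrite eqxx. Qed.

Definition triangle : sgraph := SGraph triangle_adj_sym triangle_adj_irrefl.

(* x and y are adjacent when exactly one of them is the centre [ord0]. *)
Definition star3_adj : rel 'I_4 := fun x y => (x == ord0) (+) (y == ord0).

Fact star3_adj_sym : ssrbool.symmetric star3_adj.
Proof. by move=> x y; rewrite /star3_adj addbC. Qed.

Fact star3_adj_irrefl : irreflexive star3_adj.
Proof. by move=> x; rewrite /star3_adj addbb. Qed.

Definition star3 : sgraph := SGraph star3_adj_sym star3_adj_irrefl.

Section QuadraticQuotient.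
Variables (K : fieldType) (n : nat) (r : rel 'I_n).

(* K[x_1, ..., x_n] modulo the ideal generated by the x_i x_j with r i j; the
   ideal is made a boolean predicate by classical reasoning. *)
Definition quad_ideal : pred {mpoly K[n]} := fun p =>
  `[< exists c : 'I_n -> 'I_n -> {mpoly K[n]},
      p = \sum_(i < n) \sum_(j < n | r i j) c i j * ('X_i * 'X_j) >].

Fact quad_ideal_closed : idealr_closed quad_ideal.
Proof.
split.
- apply/asboolP; exists (fun _ _ => 0).
  by rewrite big1 // => i _; rewrite big1 // => j _; rewrite mul0r.
- apply/negP => /asboolP [c /(congr1 (meval (fun=> 0)))].
  rewrite meval1 raddf_sum big1 => [|i _]; first by apply/eqP; exact: oner_neq0.
  rewrite /= raddf_sum big1 // => j _.
  by rewrite /= !rmorphM /= !mevalXU !mulr0.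
move=> a u v /asboolP[c ->] /asboolP[d ->]; apply/asboolP.
exists (fun i j => a * c i j + d i j).
rewrite mulr_sumr -big_split; apply: eq_bigr => i _ /=.
rewrite mulr_sumr -big_split; apply: eq_bigr => j _ /=.
by rewrite [RHS]mulrDl -[a * c i j * _]mulrA.
Qed.

HB.instance Definition _ :=
  isIdealr.Build {mpoly K[n]} quad_ideal quad_ideal_closed.

Definition quad_ring : Type :=
  {ideal_quot (quad_ideal : idealr {mpoly K[n]})}.

HB.instance Definition _ := GRing.ComNzRing.on quad_ring.
HB.instance Definition _ := NzRingQuotient.on quad_ring.

Definition quad_scale (a : K) (x : quad_ring) : quad_ring :=
  \pi_quad_ring (a *: repr x).

Fact pi_quad_scale a (p : {mpoly K[n]}) :
  quad_scale a (\pi_quad_ring p) = \pi_quad_ring (a *: p).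
Proof.
rewrite /quad_scale -[a *: p]mul_mpolyC -mul_mpolyC.
by rewrite !rmorphM /= reprK.
Qed.

Fact quad_scaleA a b x : quad_scale a (quad_scale b x) = quad_scale (a * b) x.
Proof.
by elim/quotW: x => p; rewrite (pi_quad_scale b) !pi_quad_scale scalerA.
Qed.

Fact quad_scale1 : left_id 1 quad_scale.
Proof. by elim/quotW=> p; rewrite pi_quad_scale scale1r. Qed.

Fact quad_scaleDr : right_distributive quad_scale +%R.
Proof.
move=> a; elim/quotW=> p; elim/quotW=> q.
by rewrite -rmorphD !pi_quad_scale scalerDr rmorphD.
Qed.

Fact quad_scaleDl x : {morph quad_scale^~ x : a b / a + b}.
Proof. by elim/quotW: x => p a b; rewrite !pi_quad_scale scalerDl rmorphD. Qed.

HB.instance Definition _ := GRing.Zmodule_isLmodule.Build K quad_ring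
  quad_scaleA quad_scale1 quad_scaleDr quad_scaleDl.

Fact quad_scaleAl (a : K) (x y : quad_ring) : a *: (x * y) = a *: x * y.
Proof.
elim/quotW: x => p; elim/quotW: y => q.
rewrite -rmorphM [LHS]pi_quad_scale scalerAl rmorphM.
by congr (_ * _); apply: esym; exact: pi_quad_scale.
Qed.

HB.instance Definition _ :=
  GRing.Lmodule_isLalgebra.Build K quad_ring quad_scaleAl.
HB.instance Definition _ :=
  GRing.Lalgebra_isComAlgebra.Build K quad_ring.

End QuadraticQuotient.

(* The variable 'X_i stands for the i-th edge in the enumeration of [edges G];
   an edge meets itself, so the squares 'X_i ^+ 2 are among the relations. *)
Definition edges_meet (G : sgraph) : rel 'I_#|edges G| := fun i j =>
  ~~ [disjoint enum_val i & enum_val j].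

Definition full_local_ring (K : fieldType) (G : sgraph) : comAlgType K :=
  quad_ring K (@edges_meet G).

Definition R3 (K : fieldType) : comAlgType K :=
  quad_ring K (fun _ _ : 'I_3 => true).

Definition alg_iso (K : fieldType) (A B : comAlgType K) : Prop :=
  exists f : {lrmorphism A -> B}, bijective f.

(* Main.v *)
From HB Require Import structures.
Require Import Defs.
From mathcomp Require Import all_boot all_algebra perm.
From mathcomp Require Import generic_quotient ring_quotient boolp mpoly.

(** An isomorphism of full local rings is turned into an isomorphism of line
    graphs, and the graphs are then recovered by Whitney's theorem.

    From rings to line graphs.  Write x_i for the edges of the first graph, y_a
    for those of the second, and let M be the matrix whose row i holds the
    coefficients of the linear part of the image of x_i.  The isomorphism need
    not respect degrees, but the squares x_i ^ 2 vanish, so the image of x_i has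
    no constant term; hence linear parts compose like matrices, and M is
    invertible ([jacobian_inv]).  If x_i x_j = 0 and y_a y_b <> 0, then the
    coefficient of y_a y_b in the product of the images gives
    M_ia M_jb + M_ib M_ja = 0 ([jacobian_rel]).  For i = j it reads
    2 M_ia M_ib = 0, so a row is never nonzero at both a and b.  As det M <> 0,
    some permutation t has M_i(t i) <> 0 for all i.  If x_i and x_j meet while
    y_(t i) and y_(t j) do not, then M_i(t j) = 0 by the case i = j, and the
    relation for i and j leaves M_i(t i) M_j(t j) = 0, a contradiction.  So t
    preserves incidence of edges; the inverse isomorphism yields a permutation
    that does the same backwards, and counting incident pairs shows that t
    also reflects incidence ([quad_ring_iso_rel]).

    From line graphs to graphs ([whitney]).  Edges through a common vertex (a
    star) go to pairwise meeting edges.  If, in both directions, the images of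
    the edges of a star again have a common vertex, then stars correspond to
    stars and the vertices can be read off ([stars_to_stars_iso]).
    Otherwise three edges xa, xb, xc of one graph G are sent to the edges of a
    triangle pqr, say to qr, rp, pq.  Every other edge at p, q or r meets
    exactly two of the sides, so every other edge of G meets exactly two of
    xa, xb, xc or none: all vertices of G are among x, a, b, c
    ([claw_cover]).  If G has no edge among a, b, c, this is the exceptional
    pair ([claw_exception]).  If it has one, say ab, its image is rs for a
    fourth vertex s, and x, a, b, c |-> r, q, p, s is an isomorphism
    ([claw_chord_iso]).

    Injective homomorphisms into a graph that has no more edges and no isolated
    vertex are isomorphisms ([hom_graph_iso]); the isomorphisms between graphs
    with at least one edge are all constructed in this way. *)

Set Implicit Arguments.
Unset Strict Implicit.
Unset Printing Implicit Defensive.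

Import GRing.Theory.

(** * Edges and connectedness *)

Section Edges.
Variable G : sgraph.
Implicit Types (x y : G) (e f : {set G}).

Lemma adj_neq x y : adj x y -> x != y.
Proof. by apply: contraTneq => ->; rewrite adj_irrefl. Qed.

Lemma edgesP e :
  reflect (exists x y, adj x y /\ e = [set x; y]) (e \in edges G).
Proof.
rewrite inE; apply: (iffP existsP) => [[x /existsP[y /andP[xy /eqP->]]]|].
  by exists x, y.
by case=> x [y [xy ->]]; exists x; apply/existsP; exists y; rewrite xy eqxx.
Qed.

Lemma edge_at e x : e \in edges G -> x \in e -> exists2 y, adj x y & e = [set x; y].
Proof.
move=> /edgesP[a [b [ab ->]]]; rewrite !inE => /orP[]/eqP->; first by exists b.
by exists a; rewrite 1?adj_sym // setUC.
Qed.

Lemma edge_eq2 e x y :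
  e \in edges G -> x \in e -> y \in e -> x != y -> e = [set x; y].
Proof.
move=> eE xe ye xy; have [z _ eq_e] := edge_at eE xe.
by move: ye; rewrite eq_e !inE eq_sym (negPf xy) => /eqP->.
Qed.

Lemma mem_edges x y : ([set x; y] \in edges G) = adj x y.
Proof.
apply/idP/idP => [xyE|xy]; last by apply/edgesP; exists x, y.
have [z xz /setP eq_xy] := edge_at xyE (set21 x y).
have := eq_xy z; rewrite !inE eqxx orbT eq_sym (negPf (adj_neq xz)) /=.
by move/eqP=> <-.
Qed.

(** The absence of multiple edges, in the form used to locate vertices. *)
Lemma edge_common_uniq e f x y : e \in edges G -> f \in edges G -> e != f ->
  x \in e -> x \in f -> y \in e -> y \in f -> x = y.
Proof.
move=> eE fE /eqP ef xe xf ye yf; apply/eqP; apply: contraT => xy.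
by case: ef; rewrite (edge_eq2 eE xe ye) // (edge_eq2 fE xf yf).
Qed.

End Edges.

Definition meet (T : finType) (e f : {set T}) := ~~ [disjoint e & f].

Lemma meetP (T : finType) (e f : {set T}) :
  reflect (exists2 x, x \in e & x \in f) (meet e f).
Proof.
rewrite /meet -setI_eq0; apply: (iffP (set0Pn _)) => [[x]|[x xe xf]].
  by rewrite inE => /andP[]; exists x.
by exists x; rewrite inE xe.
Qed.

Lemma meet_set2 (T : finType) (x y : T) (e : {set T}) :
  meet e [set x; y] = (x \in e) || (y \in e).
Proof.
apply/meetP/orP => [[z ze]|[]]; last 2 first.
- by exists x; rewrite ?set21.
- by exists y; rewrite ?set22.
by rewrite !inE => /orP[]/eqP<-; [left|right].
Qed.

Section Connected.
Variable G : sgraph.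
Hypothesis conG : connected G.
Implicit Types (x y : G) (e f : {set G}).

Lemma connected_neighbour x y : x != y -> exists z, adj x z.
Proof.
move=> xy; have /connectP[[|z p] /=] := conG.2 x y.
  by move=> _ yx; rewrite yx eqxx in xy.
by case/andP; exists z.
Qed.

Lemma connected_neighbour_edge e x : e \in edges G -> exists z, adj x z.
Proof.
move=> /edgesP[a [b [ab _]]]; have [xa|xa] := eqVneq x a.
  by exists b; rewrite xa.
exact: connected_neighbour xa.
Qed.

Lemma connected_closed (A : {set G}) x :
  x \in A -> (forall y z, y \in A -> adj y z -> z \in A) -> forall y, y \in A.
Proof.
move=> xA clA y; rewrite -(@closed_connect _ (@adj G) (mem A) _ x y) ?conG.2 //.
move=> u v uv; apply/idP/idP => [uA|vA]; first exact: clA uv.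
by apply: clA vA _; rewrite adj_sym.
Qed.

(** The vertices of an edge that meets no other edge form a connected component,
    so in a connected graph they are all the vertices. *)
Lemma connected_meet e : 1 < #|edges G| -> e \in edges G ->
  exists2 g, g \in edges G & (g != e) && meet g e.
Proof.
move=> E2 eE; apply: contrapT => noadj.
have in_e : forall y, y \in e.
  have [a [b [ab e_ab]]] := edgesP _ eE.
  apply: (connected_closed (x := a)) => [|y z ye yz]; first by rewrite e_ab set21.
  suff /eqP<- : [set y; z] == e by exact: set22.
  apply: contraT => yze; case: noadj; exists [set y; z]; first by rewrite mem_edges.
  by rewrite yze; apply/meetP; exists y; rewrite ?set21.
have sub_e : edges G \subset [set e].
  apply/subsetP=> _ /edgesP[a [b [ab ->]]].
  by rewrite inE eq_sym (edge_eq2 eE (in_e a) (in_e b)) // adj_neq.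
by have := subset_leq_card sub_e; rewrite cards1 leqNgt E2.
Qed.

End Connected.

Lemma graph_iso_sym G H : graph_iso G H -> graph_iso H G.
Proof.
case=> f [g fK gK] fadj; exists g; first by exists f.
by move=> x y; rewrite -fadj !gK.
Qed.

Lemma imset_set2 (S T : finType) (f : S -> T) x y :
  f @: [set x; y] = [set f x; f y].
Proof. by rewrite imsetU !imset_set1. Qed.

(** The edge count makes every edge of [H] the image of an edge of [G], so [f]
    reflects adjacency too; it is onto because each vertex lies on an edge. *)
Lemma hom_graph_iso (G H : sgraph) (f : G -> H) :
  injective f -> {homo f : x y / adj x y} -> #|edges H| <= #|edges G| ->
  (forall y : H, exists z, adj y z) -> graph_iso G H.
Proof.
move=> f_inj f_hom leHG nbrH.
have imE : [set f @: (e : {set G}) | e in edges G] = edges H.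
  apply/eqP; rewrite eqEcard card_imset; last exact: imset_inj.
  rewrite leHG andbT; apply/subsetP=> _ /imsetP[e /edgesP[x [y [xy ->]]] ->].
  by rewrite imset_set2 mem_edges f_hom.
have preim u v : adj u v -> exists x y, [/\ adj x y, f x = u & f y = v].
  move=> uv; have : [set u; v] \in edges H by rewrite mem_edges.
  rewrite -imE => /imsetP[e eE uv_e].
  have : u \in f @: e by rewrite -uv_e set21.
  case/imsetP=> x xe ux; have [y xy e_xy] := edge_at eE xe.
  exists x, y; split=> //; apply/eqP.
  have := set22 (f x) (f y); rewrite -imset_set2 -e_xy -uv_e !inE ux.
  by rewrite (inj_eq f_inj) eq_sym (negPf (adj_neq xy)).
exists f; last first.
  move=> x y; apply/idP/idP => [/preim[x' [y' [xy' /f_inj<- /f_inj<-]]] //|].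
  exact: f_hom.
apply: inj_card_bij => //; rewrite -[X in _ <= X](card_codom f_inj).
apply/subset_leq_card/subsetP => u _.
have [v /preim[x [_ [_ <- _]]]] := nbrH u; exact: codom_f.
Qed.

(** * Edge isomorphisms that send stars to stars *)

(** The inverse [tu] is part of the data so that the two graphs play symmetric
    roles.  The values of [sg] and [tu] outside the edge sets are arbitrary. *)
Record line_iso (G H : sgraph)
    (sg : {set G} -> {set H}) (tu : {set H} -> {set G}) : Prop := LineIso {
  line_isoE : forall e, e \in edges G -> sg e \in edges H;
  line_isoVE : forall e, e \in edges H -> tu e \in edges G;
  line_isoK : {in edges G, cancel sg tu};
  line_isoVK : {in edges H, cancel tu sg};
  line_iso_meet : {in edges G &, forall e f, meet (sg e) (sg f) = meet e f} }.

Lemma line_iso_sym G H sg tu : @line_iso G H sg tu -> line_iso tu sg.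
Proof.
case=> E VE K VK M; split=> // e f eE fE.
by rewrite -M ?VE // !VK.
Qed.

Lemma line_iso_inj G H sg tu : @line_iso G H sg tu -> {in edges G &, injective sg}.
Proof. by move=> [_ _ K _ _]; apply: can_in_inj K. Qed.

Lemma line_iso_card G H sg tu : @line_iso G H sg tu -> #|edges G| = #|edges H|.
Proof.
move=> st; apply/eqP; rewrite eqn_leq; apply/andP; split.
  rewrite -(card_in_imset (line_iso_inj st)); apply/subset_leq_card/subsetP.
  by move=> _ /imsetP[e eE ->]; apply: line_isoE st _ eE.
have ts := line_iso_sym st.
rewrite -(card_in_imset (line_iso_inj ts)); apply/subset_leq_card/subsetP.
by move=> _ /imsetP[e eE ->]; apply: line_isoE ts _ eE.
Qed.

(** Quantifying over the common vertex [w] of the images of two edges avoids any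
    choice of the centre of the image, and makes the condition void at vertices
    of degree at most 1. *)
Definition stars_to_stars (G H : sgraph) (sg : {set G} -> {set H}) : Prop :=
  forall (u : G) (w : H) e1 e2 e3,
  e1 \in edges G -> e2 \in edges G -> e3 \in edges G -> e1 != e2 ->
  u \in e1 -> u \in e2 -> u \in e3 -> w \in sg e1 -> w \in sg e2 -> w \in sg e3.

Definition star_rel (G H : sgraph) (sg : {set G} -> {set H}) u w : Prop :=
  forall e, e \in edges G -> (u \in e) = (w \in sg e).

(** The centre [w] is the common vertex of the images of two edges at [u]; the
    condition on [sg] sends the star at [u] into the star at [w], the one on
    [tu] sends it back. *)
Lemma star_rel_deg2 G H sg tu : @line_iso G H sg tu ->
  stars_to_stars sg -> stars_to_stars tu ->
  forall u e1 e2, e1 \in edges G -> e2 \in edges G -> e1 != e2 ->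
  u \in e1 -> u \in e2 -> exists w, star_rel sg u w.
Proof.
move=> st Ss St u e1 e2 E1 E2 e12 ue1 ue2.
have : meet (sg e1) (sg e2).
  by rewrite (line_iso_meet st) //; apply/meetP; exists u.
case/meetP=> w we1 we2; exists w => e eE; apply/idP/idP => [ue|we].
  exact: (Ss u w e1 e2 e).
have se12 : sg e1 != sg e2 by rewrite (inj_in_eq (line_iso_inj st)).
have := St w u (sg e1) (sg e2) (sg e).
by rewrite !(line_isoK st) //; apply=> //; apply: line_isoE st _ _.
Qed.

(** For the remaining vertices, the ends [u] of a pendant edge [uv], the vertex
    [v] has degree at least 2, hence a partner [w'], and [u] is paired with the
    other end [w] of the image of [uv].  The vertex [w] is on no further edge:
    otherwise it would be the partner of [u] or [v], but [u] is on one edge only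
    and the partner of [v] is [w']. *)
Lemma star_rel_exists G H sg tu : connected G -> @line_iso G H sg tu ->
  stars_to_stars sg -> stars_to_stars tu -> 1 < #|edges G| ->
  forall u, exists w, star_rel sg u w.
Proof.
move=> conG st Ss St E2 u; have /card_gt0P[e0 E0] := ltnW E2.
have [v uv] := connected_neighbour_edge conG u E0.
have eE : [set u; v] \in edges G by rewrite mem_edges.
set e := [set u; v] in eE.
have ue : u \in e by exact: set21.
have ve : v \in e by exact: set22.
have [[f [fE fe uf]]|leaf] :=
  pselect (exists f, [/\ f \in edges G, f != e & u \in f]).
  exact: star_rel_deg2 st Ss St _ _ _ fE eE fe uf ue.
have [f fE /andP[fe]] := connected_meet conG E2 eE.
rewrite meet_set2 => /orP[uf|vf]; first by case: leaf; exists f.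
have [w' vw'] := star_rel_deg2 st Ss St fE eE fe vf ve.
have seE := line_isoE st eE.
have w'e : w' \in sg e by rewrite -vw'.
have [w w'w se] := edge_at seE w'e.
have we : w \in sg e by rewrite se set22.
exists w => g gE; have [->|ge] := eqVneq g e; first by rewrite ue we.
apply/idP/idP => [ug|wg]; first by case: leaf; exists g.
have sge : sg g != sg e by rewrite (inj_in_eq (line_iso_inj st)).
have sgE := line_isoE st gE.
have [z wz] := star_rel_deg2 (line_iso_sym st) St Ss sgE seE sge wg we.
move: (wz _ seE) (wz _ sgE); rewrite !(line_isoK st) // we wg.
rewrite !inE => /esym/orP[]/eqP-> // /esym vg.
have w'g : w' \in sg g by rewrite -vw'.
have ww' := edge_common_uniq sgE seE sge wg we w'g w'e.
by rewrite ww' adj_irrefl in w'w.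
Qed.

(** Two vertices with the same star are the ends of an edge that meets no other,
    which connectedness excludes as soon as there are two edges; so pairing
    stars is injective on vertices. *)
Lemma stars_to_stars_iso G H sg tu : connected G -> connected H ->
  @line_iso G H sg tu -> stars_to_stars sg -> stars_to_stars tu ->
  1 < #|edges G| -> graph_iso G H.
Proof.
move=> conG conH st Ss St E2.
have [f fP] := boolp.choice (star_rel_exists conG st Ss St E2).
have /card_gt0P[e0 E0] := ltnW E2.
have f_inj : injective f.
  move=> u v fuv; apply/eqP; apply: contraT => uv.
  have same e : e \in edges G -> (u \in e) = (v \in e).
    by move=> eE; rewrite (fP u) // (fP v) // fuv.
  have [z uz] := connected_neighbour conG uv.
  have eE : [set u; z] \in edges G by rewrite mem_edges.
  have := same _ eE; rewrite set21 => /esym ve.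
  have e_uv := edge_eq2 eE (set21 _ _) ve uv.
  have [g gE /andP[ge]] := connected_meet conG E2 eE.
  rewrite e_uv meet_set2 -same // orbb => ug.
  have vg : v \in g by rewrite -same.
  case/eqP: uv; apply: (edge_common_uniq gE eE ge ug (set21 _ _) vg ve).
apply: (hom_graph_iso f_inj); last 1 first.
- move=> y; apply: (connected_neighbour_edge conH y (line_isoE st E0)).
- move=> x y xy; have eE : [set x; y] \in edges G by rewrite mem_edges.
  rewrite -mem_edges -(edge_eq2 (line_isoE st eE) (x := f x) (y := f y)).
  + exact: line_isoE st _ eE.
  + by rewrite -fP ?set21.
  + by rewrite -fP ?set22.
  + by rewrite (inj_eq f_inj) adj_neq.
by rewrite (line_iso_card st).
Qed.

(** * Graphs with few edges, the triangle and the star *)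

Lemma edgeless_iso G H : connected G -> connected H ->
  #|edges G| = 0 -> #|edges H| = 0 -> graph_iso G H.
Proof.
have noadj (F : sgraph) : #|edges F| = 0 -> forall x y : F, adj x y = false.
  by move/eqP; rewrite cards_eq0 => /eqP E0 x y; rewrite -mem_edges E0 inE.
have one (F : sgraph) : connected F -> #|edges F| = 0 ->
    exists x : F, forall y, y = x.
  move=> conF F0; have /card_gt0P[x _] := conF.1; exists x => y; apply/eqP.
  by apply: contraT => /(connected_neighbour conF)[z]; rewrite noadj.
move=> conG conH G0 H0; have [x xP] := one G conG G0; have [y yP] := one H conH H0.
exists (fun=> y); last by move=> u v; rewrite !noadj.
by exists (fun=> x) => u; rewrite ?xP ?yP //; apply/esym.
Qed.

Lemma single_edge_iso G H : connected G -> connected H ->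
  #|edges G| = 1 -> #|edges H| = 1 -> graph_iso G H.
Proof.
move=> conG conH /eqP/cards1P[e Ee] H1.
have eE : e \in edges G by rewrite Ee set11.
have [a [b [ab e_ab]]] := edgesP _ eE.
have /eqP/cards1P[e' Ee'] := H1.
have e'E : e' \in edges H by rewrite Ee' set11.
have [p [q [pq _]]] := edgesP _ e'E.
have allG : forall x, x \in e.
  apply: (connected_closed conG (x := a)) => [|x y xe xy].
    by rewrite e_ab set21.
  have : [set x; y] \in edges G by rewrite mem_edges.
  by rewrite Ee inE => /eqP<-; rewrite set22.
pose f x := if x == a then p else q.
have fa : f a = p by rewrite /f eqxx.
have fb : f b = q by rewrite /f eq_sym (negPf (adj_neq ab)).
have f_hom : forall x y, x != y -> adj (f x) (f y).
  move=> x y; move: (allG x) (allG y); rewrite e_ab !inE.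
  move=> /orP[]/eqP-> /orP[]/eqP->; rewrite ?eqxx // fa fb //.
  by rewrite adj_sym.
apply: (hom_graph_iso (f := f)).
- move=> x y fxy; apply/eqP; apply: contraT => /f_hom.
  by rewrite fxy adj_irrefl.
- by move=> x y /adj_neq/f_hom.
- by rewrite H1 Ee cards1.
by move=> y; apply: (connected_neighbour_edge conH y e'E).
Qed.

Lemma card_edges_triangle : #|edges triangle| = 3.
Proof.
transitivity #|[set A : {set 'I_3} | #|A| == 2]|; last first.
  by rewrite card_draws card_ord.
apply: eq_card => A; rewrite [RHS]inE; apply/edgesP/idP => [[x [y [xy ->]]]|].
  by rewrite cards2 (_ : x != y).
by case/cards2P => x [y [xy ->]]; exists x, y.
Qed.

Lemma edges_star3 : edges star3 = [set [set ord0; lift ord0 i] | i : 'I_3].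
Proof.
apply/setP=> e; apply/edgesP/imsetP => [[x [y [xy ->]]]|[i _ ->]]; last first.
  by exists ord0, (lift ord0 i).
wlog x0 : x y xy / x = ord0.
  move=> IH; move: (xy); rewrite /= /star3_adj.
  have [x0 _|x0] := eqVneq x ord0; first exact: IH.
  by move=> /= /eqP y0; rewrite setUC; apply: IH => //; rewrite adj_sym.
have : ord0 != y by move: xy; rewrite x0 /= /star3_adj eqxx eq_sym; case: eqP.
rewrite x0.
by case/unlift_some => j -> _; exists j.
Qed.

Lemma card_edges_star3 : #|edges star3| = 3.
Proof.
rewrite edges_star3 card_imset ?card_ord // => i j /setP/(_ (lift ord0 i)).
rewrite !inE eqxx orbT eq_sym (negPf (neq_lift _ _)) /=.
by move/esym/eqP/lift_inj.
Qed.

(** * A claw sent to a triangle *)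

(** The labels are matched so that the image of [xa] is the side opposite to [p],
    and likewise for [b], [q] and for [c], [r]; the situation is then invariant
    under simultaneous rotation of [a, b, c] and [p, q, r]. *)
Record claw_to_triangle (G H : sgraph) (sg : {set G} -> {set H})
    (x a b c : G) (p q r : H) : Prop := ClawToTriangle {
  claw_uniq : uniq [:: x; a; b; c];
  claw_adjs : [/\ adj x a, adj x b & adj x c];
  claw_trg_uniq : uniq [:: p; q; r];
  claw_imgs : [/\ sg [set x; a] = [set q; r], sg [set x; b] = [set r; p]
                & sg [set x; c] = [set p; q]] }.

Lemma claw_to_triangle_rot G H sg x a b c p q r :
  @claw_to_triangle G H sg x a b c p q r -> claw_to_triangle sg x b c a q r p.
Proof.
case=> U [xa xb xc] V [ia ib ic]; split=> //.
  by rewrite -[_ :: _]/(x :: rot 1 [:: a; b; c]) cons_uniq mem_rot rot_uniq.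
by rewrite -[_ :: _]/(rot 1 [:: p; q; r]) rot_uniq.
Qed.

(** Let the images of two edges at [u] meet in [r].  The image of a third edge at
    [u] that misses [r] meets each of them at its other end, which closes a
    triangle. *)
Lemma not_stars_to_stars G H sg tu : @line_iso G H sg tu -> ~ stars_to_stars sg ->
  exists x a b c p q r, claw_to_triangle sg x a b c p q r.
Proof.
move=> st nSs; apply: contrapT => noclaw; apply: nSs.
move=> u r e1 e2 e3 E1 E2 E3 e12 u1 u2 u3 r1 r2; apply: contraT => r3.
have e13 : e1 != e3 by apply: contraNneq r3 => <-.
have e23 : e2 != e3 by apply: contraNneq r3 => <-.
have neq_sg e f : e \in edges G -> f \in edges G -> e != f -> sg e != sg f.
  by move=> eE fE; rewrite (inj_in_eq (line_iso_inj st)).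
have meetu e f : e \in edges G -> f \in edges G -> u \in e -> u \in f ->
    meet (sg e) (sg f).
  by move=> eE fE ue uf; rewrite (line_iso_meet st) //; apply/meetP; exists u.
have /meetP[q q1 q3] := meetu _ _ E1 E3 u1 u3.
have /meetP[p p2 p3] := meetu _ _ E2 E3 u2 u3.
have qr : q != r by apply: contraNneq r3 => <-.
have pr : p != r by apply: contraNneq r3 => <-.
have S1 := line_isoE st E1; have S2 := line_isoE st E2; have S3 := line_isoE st E3.
have pq : p != q.
  apply: contraNneq qr => pq; apply/eqP.
  by apply: (edge_common_uniq S1 S2 (neq_sg _ _ E1 E2 e12)); rewrite // -pq.
have [a ua e1a] := edge_at E1 u1.
have [b ub e2b] := edge_at E2 u2.
have [c uc e3c] := edge_at E3 u3.
case: noclaw; exists u, a, b, c, p, q, r; split; first 1 last.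
- by [].
- by rewrite /= !inE negb_or pq pr qr.
- rewrite -e1a -e2b -e3c; split.
  + exact: edge_eq2.
  + by apply: edge_eq2; rewrite // eq_sym.
  + exact: edge_eq2.
have nab : a != b by apply: contraNneq e12 => ab; rewrite e1a e2b ab.
have nac : a != c by apply: contraNneq e13 => ac; rewrite e1a e3c ac.
have nbc : b != c by apply: contraNneq e23 => bc; rewrite e2b e3c bc.
by rewrite /= !inE !negb_or (adj_neq ua) (adj_neq ub) (adj_neq uc) nab nac nbc.
Qed.

Section Analysis.
Variables (G H : sgraph) (sg : {set G} -> {set H}) (tu : {set H} -> {set G}).
Hypothesis st : line_iso sg tu.

(** The image of an edge at [x] meets all three sides, so it contains two corners
    of the triangle and is one of the sides. *)
Lemma claw_centre x a b c p q r z : claw_to_triangle sg x a b c p q r ->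
  adj x z -> z \in [:: a; b; c].
Proof.
case=> _ [xa xb xc] V [ia ib ic] xz.
have zE : [set x; z] \in edges G by rewrite mem_edges.
have edge_img y : adj x y -> sg [set x; z] = sg [set x; y] -> z = y.
  move=> xy eq_sg; have yE : [set x; y] \in edges G by rewrite mem_edges.
  have /setP/(_ z) := line_iso_inj st zE yE eq_sg.
  by rewrite !inE eqxx orbT eq_sym (negPf (adj_neq xz)) => /esym/eqP.
have meetx y : adj x y -> meet (sg [set x; z]) (sg [set x; y]).
  move=> xy; rewrite (line_iso_meet st) ?mem_edges //.
  by apply/meetP; exists x; rewrite set21.
have sE := line_isoE st zE.
have two u v : u \in sg [set x; z] -> v \in sg [set x; z] -> u != v ->
  sg [set x; z] = [set u; v] by apply: edge_eq2.
move: V; rewrite /= !inE negb_or andbT => /andP[/andP[pq pr] qr].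
have zc : p \in sg [set x; z] -> q \in sg [set x; z] -> z = c.
  by move=> pz qz; apply: edge_img; rewrite // ic; apply: two.
have zb : p \in sg [set x; z] -> r \in sg [set x; z] -> z = b.
  by move=> pz rz; apply: edge_img; rewrite // ib; apply: two; rewrite // eq_sym.
have za : q \in sg [set x; z] -> r \in sg [set x; z] -> z = a.
  by move=> qz rz; apply: edge_img; rewrite // ia; apply: two.
move: (meetx _ xa) (meetx _ xb) (meetx _ xc); rewrite ia ib ic !meet_set2.
case/orP=> [qz|rz] /orP[rz'|pz] /orP[pz'|qz'].
all: try by rewrite za ?eqxx.
all: try by rewrite zb ?eqxx ?orbT.
all: by rewrite zc ?eqxx ?orbT.
Qed.

(** An edge at [a] that avoids [x] meets [xa], so its image contains [q] or [r].
    Being on a second side too, the image meets that of [xc] or [xb], which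
    determines the other end. *)
Lemma claw_tip x a b c p q r z : claw_to_triangle sg x a b c p q r ->
  adj a z -> z != x ->
  (z = b /\ r \in sg [set a; b]) \/ (z = c /\ q \in sg [set a; c]).
Proof.
case=> U [xa xb xc] V [ia ib ic] az zx.
have aE : [set a; z] \in edges G by rewrite mem_edges.
have x_az : x \notin [set a; z] by rewrite !inE negb_or adj_neq //= eq_sym.
have meetz y : adj x y -> y != a -> meet (sg [set a; z]) (sg [set x; y]) -> z = y.
  move=> xy ya; rewrite (line_iso_meet st) ?mem_edges // meet_set2.
  by rewrite (negPf x_az) /= !inE (negPf ya) => /eqP.
have : meet (sg [set a; z]) (sg [set x; a]).
  by rewrite (line_iso_meet st) ?mem_edges // meet_set2 set21 orbT.
move: U; rewrite /= !inE !negb_or => /and4P[_ /andP[ab ac] _ _].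
rewrite ia meet_set2 => /orP[qz|rz]; [right|left].
  have zc : z = c by apply: meetz; rewrite // 1?eq_sym // ic meet_set2 qz orbT.
  by rewrite -zc.
have zb : z = b by apply: meetz; rewrite // 1?eq_sym // ib meet_set2 rz.
by rewrite -zb.
Qed.

(** If the image of [ab] contained a second corner, it would be one of the sides,
    that is, the image of an edge at [x]. *)
Lemma claw_img x a b c p q r : claw_to_triangle sg x a b c p q r ->
  adj a b -> [/\ r \in sg [set a; b], p \notin sg [set a; b]
                & q \notin sg [set a; b]].
Proof.
move=> C ab; have [U [xa xb xc] V [ia ib ic]] := C.
have abE : [set a; b] \in edges G by rewrite mem_edges.
move: U; rewrite /= !inE !negb_or.
move=> /and4P[/and3P[nxa nxb nxc] /andP[nab nac] nbc _].
have r_ab : r \in sg [set a; b].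
  have [[_ //]|[/eqP]] := claw_tip C ab (contra_neq esym nxb).
  by rewrite (negPf nbc).
move: V; rewrite /= !inE negb_or andbT => /andP[/andP[pq pr] qr].
have not_img y u : adj x y -> sg [set x; y] = [set r; u] -> u != r ->
    u \notin sg [set a; b].
  move=> xy iy ur; apply/negP => u_ab.
  have eq_sg : sg [set a; b] = sg [set x; y].
    by rewrite iy; apply: edge_eq2; rewrite // 1?eq_sym // (line_isoE st).
  have yE : [set x; y] \in edges G by rewrite mem_edges.
  have /setP/(_ x) := line_iso_inj st abE yE eq_sg.
  by rewrite !inE eqxx (negPf nxa) (negPf nxb).
split=> //; first exact: not_img xb ib pr.
by apply: not_img xa _ qr; rewrite ia setUC.
Qed.

Lemma claw_cover x a b c p q r : connected G ->
  claw_to_triangle sg x a b c p q r -> forall z, z \in [:: x; a; b; c].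
Proof.
move=> conG C z; have C1 := claw_to_triangle_rot C.
have C2 := claw_to_triangle_rot C1.
suff : z \in [set v in [:: x; a; b; c]] by rewrite inE.
apply: (connected_closed conG (x := x)) => [|u v]; first by rewrite inE mem_head.
rewrite !inE => uABC uv; have [//|vx] := eqVneq v x.
case/or4P: uABC uv => /eqP->.
- by move/(claw_centre C); rewrite !inE.
- by case/(claw_tip C)=> // -[-> _]; rewrite eqxx ?orbT.
- by case/(claw_tip C1)=> // -[-> _]; rewrite eqxx ?orbT.
- by case/(claw_tip C2)=> // -[-> _]; rewrite eqxx ?orbT.
Qed.

(** The isomorphism [x, a, b, c |-> r, q, p, s], where [rs] is the image of [ab],
    does not induce [sg]: it exchanges the images of [xc] and [ab], two
    disjoint edges that meet the same other edges.  The remaining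
    possible edges [bc] and [ca] go to [ps] and [sq], because their images
    contain [p], resp. [q], and meet the image [rs] of [ab] away from [r]. *)
Lemma claw_chord_iso x a b c p q r : connected G -> connected H ->
  claw_to_triangle sg x a b c p q r -> adj a b -> graph_iso G H.
Proof.
move=> conG conH C ab; have cover := claw_cover conG C.
have [U [xa xb xc] V [ia ib ic]] := C.
have C1 := claw_to_triangle_rot C; have C2 := claw_to_triangle_rot C1.
have sE u v : adj u v -> sg [set u; v] \in edges H.
  by move=> uv; apply: line_isoE st _ _; rewrite mem_edges.
have [r_ab p_ab q_ab] := claw_img C ab.
have [s rs ab_rs] := edge_at (sE _ _ ab) r_ab.
move: p_ab q_ab; rewrite ab_rs !inE !negb_or => /andP[pr ps] /andP[qr qs].
have pq : p != q by move: V; rewrite /= !inE negb_or => /andP[/andP[]].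
have sr : s != r by rewrite eq_sym adj_neq.
have meet_ab u v : adj u v -> (u \in [set a; b]) || (v \in [set a; b]) ->
    (r \notin sg [set u; v]) -> s \in sg [set u; v].
  move=> uv; rewrite -meet_set2 -(line_iso_meet st) ?mem_edges //.
  by case/meetP=> w; rewrite ab_rs !inE => /orP[]/eqP-> -> //.
have adj_img u v y z : adj u v -> y \in sg [set u; v] -> z \in sg [set u; v] ->
    y != z -> adj y z.
  by move=> uv yuv zuv yz; rewrite -mem_edges -(edge_eq2 (sE _ _ uv) yuv zuv yz) sE.
have bc_ps : adj b c -> adj p s.
  move=> bc; have [p_bc _ r_bc] := claw_img C1 bc.
  by apply: (adj_img b c); rewrite // meet_ab // set22.
have ca_qs : adj c a -> adj q s.
  move=> ca; have [q_ca r_ca _] := claw_img C2 ca.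
  by apply: (adj_img c a); rewrite // meet_ab // set21 orbT.
have rq : adj r q by rewrite -mem_edges setUC -ia sE.
have rp : adj r p by rewrite -mem_edges -ib sE.
have qp : adj q p by rewrite -mem_edges setUC -ic sE.
pose f v := nth r [:: r; q; p; s] (index v [:: x; a; b; c]).
have f_inj : injective f.
  move=> u v /eqP; rewrite /f nth_uniq ?index_mem //.
    by move/eqP/(congr1 (nth x [:: x; a; b; c])); rewrite !nth_index.
  by rewrite /= !inE !negb_or !(eq_sym r) (eq_sym q p) pq pr qr sr ps qs.
move: U; rewrite /= !inE !negb_or.
move=> /and4P[/and3P[nxa nxb nxc] /andP[nab nac] nbc _].
have fx : f x = r by rewrite /f /= eqxx.
have fa : f a = q by rewrite /f /= (negPf nxa) eqxx.
have fb : f b = p by rewrite /f /= (negPf nxb) (negPf nab) eqxx.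
have fc : f c = s by rewrite /f /= (negPf nxc) (negPf nac) (negPf nbc) eqxx.
apply: (hom_graph_iso f_inj).
- move=> u v; move: (cover u) (cover v); rewrite !inE.
  move=> /or4P[]/eqP-> /or4P[]/eqP->; rewrite ?adj_irrefl // ?(fx, fa, fb, fc) //.
  + by rewrite adj_sym (adj_sym q).
  + by rewrite (adj_sym a) => /ca_qs.
  + by rewrite adj_sym (adj_sym p).
  + by rewrite adj_sym (adj_sym p).
  + by rewrite adj_sym (adj_sym s).
  + by move/ca_qs; rewrite adj_sym.
  + by rewrite adj_sym => /bc_ps; rewrite adj_sym.
- by rewrite (line_iso_card st).
by move=> y; apply: (connected_neighbour_edge conH y (sE _ _ ab)).
Qed.

Lemma claw_exception x a b c p q r : connected G -> connected H ->
  claw_to_triangle sg x a b c p q r ->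
  ~~ adj a b -> ~~ adj b c -> ~~ adj c a ->
  graph_iso G star3 /\ graph_iso H triangle.
Proof.
move=> conG conH C nadj_ab nadj_bc nadj_ca; have cover := claw_cover conG C.
have [U [xa xb xc] V [ia ib ic]] := C.
have nadj_ba : ~~ adj b a by rewrite adj_sym.
have nadj_cb : ~~ adj c b by rewrite adj_sym.
have nadj_ac : ~~ adj a c by rewrite adj_sym.
have nadj := (negPf nadj_ab, negPf nadj_bc, negPf nadj_ca,
              negPf nadj_ba, negPf nadj_cb, negPf nadj_ac).
have edgesG e : e \in edges G -> e \in [:: [set x; a]; [set x; b]; [set x; c]].
  case/edgesP=> u [v [uv ->]]; move: (cover u) (cover v) uv; rewrite !inE.
  move=> /or4P[]/eqP-> /or4P[]/eqP->; rewrite ?nadj ?adj_irrefl ?eqxx ?orbT //;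
  by rewrite [[set _; x]]setUC eqxx ?orbT.
have cardG : #|edges G| <= 3.
  apply: leq_trans (card_size [:: [set x; a]; [set x; b]; [set x; c]]).
  exact/subset_leq_card/subsetP.
have cardH : #|edges H| <= 3 by rewrite -(line_iso_card st).
have xaE : [set x; a] \in edges G by rewrite mem_edges.
split; apply: graph_iso_sym.
  pose f : star3 -> G := tnth [tuple x; a; b; c].
  apply: (hom_graph_iso (f := f)).
  - exact/tuple_uniqP.
  - case=> [[|[|[|[|//]]]] i]; case=> [[|[|[|[|//]]]] j] //= _;
    by rewrite /f !(tnth_nth x) //= adj_sym.
  - by rewrite card_edges_star3.
  by move=> y; apply: (connected_neighbour_edge conG y xaE).
pose f : triangle -> H := tnth [tuple p; q; r].
have sE u v : adj u v -> sg [set u; v] \in edges H.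
  by move=> uv; apply: line_isoE st _ _; rewrite mem_edges.
have qr : adj q r by rewrite -mem_edges -ia sE.
have rp : adj r p by rewrite -mem_edges -ib sE.
have pq : adj p q by rewrite -mem_edges -ic sE.
apply: (hom_graph_iso (f := f)).
- exact/tuple_uniqP.
- case=> [[|[|[|//]]] i]; case=> [[|[|[|//]]] j] //= _;
  by rewrite /f !(tnth_nth p) //= adj_sym.
- by rewrite card_edges_triangle.
by move=> y; apply: (connected_neighbour_edge conH y (sE _ _ xa)).
Qed.

End Analysis.

Lemma claw_case G H sg tu : connected G -> connected H -> @line_iso G H sg tu ->
  ~ stars_to_stars sg ->
  graph_iso G H \/ graph_iso G star3 /\ graph_iso H triangle.
Proof.
move=> conG conH st /(not_stars_to_stars st)[x [a [b [c [p [q [r C]]]]]]].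
have C1 := claw_to_triangle_rot C; have C2 := claw_to_triangle_rot C1.
have [ab|nab] := boolP (adj a b).
  by left; apply: (claw_chord_iso st conG conH C ab).
have [bc|nbc] := boolP (adj b c).
  by left; apply: (claw_chord_iso st conG conH C1 bc).
have [ca|nca] := boolP (adj c a).
  by left; apply: (claw_chord_iso st conG conH C2 ca).
by right; apply: (claw_exception st conG conH C).
Qed.

(** * Whitney's theorem *)

Theorem whitney G H sg tu : connected G -> connected H -> @line_iso G H sg tu ->
  [\/ graph_iso G H, graph_iso G triangle /\ graph_iso H star3
    | graph_iso G star3 /\ graph_iso H triangle].
Proof.
move=> conG conH st; have ts := line_iso_sym st; have cardGH := line_iso_card st.
have [Ss|nSs] := pselect (stars_to_stars sg); last first.
  by case: (claw_case conG conH st nSs); [apply: Or31|apply: Or33].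
have [St|nSt] := pselect (stars_to_stars tu); last first.
  case: (claw_case conH conG ts nSt) => [/graph_iso_sym|[Hs Gt]]; first exact: Or31.
  exact: Or32.
apply: Or31; case G2 : (#|edges G|) => [|[|n]].
- by apply: edgeless_iso; rewrite -?cardGH.
- by apply: single_edge_iso; rewrite -?cardGH.
by apply: stars_to_stars_iso conG conH st Ss St _; rewrite G2.
Qed.

(** Outside the edges, where nothing is required, the maps take the value
    [set0]. *)
Lemma edges_meet_line_iso (G H : sgraph) (t : 'I_#|edges G| -> 'I_#|edges H|) :
  bijective t -> {mono t : i j / edges_meet i j} ->
  exists sg tu, @line_iso G H sg tu.
Proof.
have extend (F F' : sgraph) (h : 'I_#|edges F| -> 'I_#|edges F'|) :
    exists sg : {set F} -> {set F'}, forall i, sg (enum_val i) = enum_val (h i).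
  exists (fun e =>
    if [pick i | enum_val i == e] is Some i then enum_val (h i) else set0).
  by move=> i; case: pickP => [j /eqP/enum_val_inj->|/(_ i)]; rewrite ?eqxx.
have enumE (F : sgraph) (e : {set F}) : e \in edges F ->
    exists i : 'I_#|edges F|, e = enum_val i.
  by move=> eE; exists (enum_rank_in eE e); rewrite enum_rankK_in.
case=> u tK uK tmono; have [sg sgE] := extend _ _ t; have [tu tuE] := extend _ _ u.
exists sg, tu.
split=> [_ /enumE[i ->]|_ /enumE[i ->]|_ /enumE[i ->]|_ /enumE[i ->]|].
- by rewrite sgE enum_valP.
- by rewrite tuE enum_valP.
- by rewrite sgE tuE tK.
- by rewrite tuE sgE uK.
by move=> _ _ /enumE[i ->] /enumE[j ->]; rewrite !sgE; apply: tmono.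
Qed.

(** What the triangle and the three-pointed star have in common, and all that their
    full local rings depend on. *)
Definition three_meeting_edges (G : sgraph) : Prop :=
  #|edges G| = 3 /\ {in edges G &, forall e f, meet e f}.

Lemma three_meeting_edges_iso G H :
  graph_iso G H -> three_meeting_edges H -> three_meeting_edges G.
Proof.
move=> GH [H3 Hmeet]; have [g g_bij g_adj] := graph_iso_sym GH.
have [f f_bij f_adj] := GH.
have le_edges (F F' : sgraph) (h : F -> F') : bijective h ->
    {mono h : x y / adj x y} -> #|edges F| <= #|edges F'|.
  move=> /bij_inj h_inj h_adj; rewrite -(card_imset _ (imset_inj h_inj)).
  apply/subset_leq_card/subsetP => _ /imsetP[_ /edgesP[x [y [xy ->]]] ->].
  by rewrite imset_set2 mem_edges h_adj.
split.
  by apply/eqP; rewrite eqn_leq -H3 !(le_edges _ _ f, le_edges _ _ g).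
have img e : e \in edges G -> f @: e \in edges H.
  by move=> /edgesP[x [y [xy ->]]]; rewrite imset_set2 mem_edges f_adj.
move=> e e' eE e'E.
have : meet (f @: e) (f @: e') by apply: Hmeet; apply: img.
case/meetP=> _ /imsetP[x xe ->].
by rewrite (mem_imset _ _ (bij_inj f_bij)) => xe'; apply/meetP; exists x.
Qed.

Lemma three_meeting_edges_triangle : three_meeting_edges triangle.
Proof.
split=> [|e f /edgesP[x [y [xy ->]]] /edgesP[z [t [zt ->]]]].
  exact: card_edges_triangle.
apply: contraT => /negPn; rewrite -setI_eq0 => /eqP dis.
have := max_card (mem ([set x; y] :|: [set z; t])).
by rewrite cardsU dis cards0 !cards2 (_ : x != y) // (_ : z != t) // card_ord.
Qed.

Lemma three_meeting_edges_star3 : three_meeting_edges star3.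
Proof.
split=> [|e f]; first exact: card_edges_star3.
rewrite edges_star3 => /imsetP[i _ ->] /imsetP[j _ ->].
by apply/meetP; exists ord0; rewrite set21.
Qed.

(** * Low-order coefficients of polynomials *)

Local Open Scope ring_scope.
Local Open Scope quotient_scope.

Section PolynomialJets.
Variables (K : fieldType) (n : nat).
Implicit Types (p q : {mpoly K[n]}) (a b i : 'I_n).

(** Coefficients are taken as derivatives at the origin, so that the product rules
    below come from Leibniz' rule.  For [a != b], [mixed_coef a b p] is the
    coefficient of ['X_a * 'X_b]. *)
Definition const_term p : K := p.@[fun=> 0].
Definition lin_coef a p : K := const_term p^`M(a).
Definition mixed_coef a b p : K := lin_coef b p^`M(a).

Lemma const_termM p q : const_term (p * q) = const_term p * const_term q.
Proof. by rewrite /const_term mevalM. Qed.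

Lemma lin_coefM a p q :
  lin_coef a (p * q) = lin_coef a p * const_term q + const_term p * lin_coef a q.
Proof. by rewrite /lin_coef mderivM /const_term mevalD !mevalM. Qed.

Lemma mixed_coefM a b p q :
  mixed_coef a b (p * q) =
    mixed_coef a b p * const_term q + lin_coef a p * lin_coef b q
    + (lin_coef b p * lin_coef a q + const_term p * mixed_coef a b q).
Proof.
by rewrite /mixed_coef mderivM /lin_coef mderivD /const_term mevalD -!lin_coefM.
Qed.

Lemma const_termX i : const_term 'X_i = 0.
Proof. by rewrite /const_term mevalXU. Qed.

Lemma mderivXU a i : ('X_i)^`M(a) = (i == a)%:R%:MP :> {mpoly K[n]}.
Proof.
rewrite mderivX mnm1E; case: eqP => [->|_].
  have ->: (U_(a) - U_(a) = 0)%MM by apply/mnmP=> j; rewrite mnmBE subnn mnm0E.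
  by rewrite mpolyX0 scale1r mpolyC1.
by rewrite scale0r mpolyC0.
Qed.

Lemma lin_coefX a i : lin_coef a 'X_i = (i == a)%:R.
Proof. by rewrite /lin_coef mderivXU /const_term mevalC. Qed.

Lemma const_term_linear c p q :
  const_term (c *: p + q) = c * const_term p + const_term q.
Proof. by rewrite /const_term mevalD mevalZ. Qed.

Lemma lin_coef_linear a c p q :
  lin_coef a (c *: p + q) = c * lin_coef a p + lin_coef a q.
Proof. by rewrite /lin_coef mderivD mderivZ const_term_linear. Qed.

Lemma mixed_coef_linear a b c p q :
  mixed_coef a b (c *: p + q) = c * mixed_coef a b p + mixed_coef a b q.
Proof. by rewrite /mixed_coef mderivD mderivZ lin_coef_linear. Qed.

Lemma mpoly_gen_ind (P : {mpoly K[n]} -> Prop) :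
  P 1 -> (forall i, P 'X_i) -> (forall c p q, P p -> P q -> P (c *: p + q)) ->
  (forall p q, P p -> P q -> P (p * q)) -> forall p, P p.
Proof.
move=> P1 PX PD PM; have P0 : P 0.
  by have := PD (-1) 1 1 P1 P1; rewrite scaleN1r addNr.
elim/mpolyind=> // c m p _ _ Pp; apply: PD => //.
rewrite mpolyXE_id; apply: big_ind => // i _.
by elim: (m i) => [|k IHk]; rewrite ?expr0 // exprS; apply: PM.
Qed.

(** A point derivation at the origin is determined by its values on the
    variables; this is the chain rule to first order. *)
Lemma lin_functional_expand (D : {mpoly K[n]} -> K) :
  (forall c p q, D (c *: p + q) = c * D p + D q) ->
  (forall p q, D (p * q) = D p * const_term q + const_term p * D q) ->
  forall p, D p = \sum_a lin_coef a p * D 'X_a.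
Proof.
move=> DL DM; elim/mpoly_gen_ind => [|i|c p q IHp IHq|p q IHp IHq].
- have D1 : D 1 = 0.
    have := DM 1 1; rewrite mulr1 /const_term meval1 mulr1 mul1r.
    by move/eqP; rewrite -[X in X == _]addr0 (inj_eq (addrI _)) eq_sym => /eqP.
  rewrite D1 big1 // => a _.
  by rewrite /lin_coef -mpolyC1 mderivC /const_term meval0 mul0r.
- rewrite (bigD1 i) //= lin_coefX eqxx mul1r big1 ?addr0 // => a ai.
  by rewrite lin_coefX eq_sym (negPf ai) mul0r.
- rewrite DL IHp IHq mulr_sumr -big_split; apply: eq_bigr => a _ /=.
  by rewrite lin_coef_linear mulrDl mulrA.
rewrite DM IHp IHq mulr_sumr mulr_suml -big_split; apply: eq_bigr => a _ /=.
by rewrite lin_coefM mulrDl mulrA mulrAC.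
Qed.

End PolynomialJets.

(** * Low-order coefficients in the quotient ring *)

Section QuadRingJets.
Variables (K : fieldType) (n : nat) (r : rel 'I_n).
Hypothesis r_sym : ssrbool.symmetric r.
Implicit Types (p q : {mpoly K[n]}) (a b i : 'I_n).

Lemma pi_quad_eq p q :
  \pi_(quad_ring K r) p = \pi_(quad_ring K r) q <-> quad_ideal r (p - q).
Proof.
split=> [pq|Ipq].
  by have := Quotient.idealrBE (quad_ideal r : idealr _) p q;
    rewrite -[quad_ideal r _]/(p - q \in (quad_ideal r : idealr _)) => ->; apply/eqP.
apply/eqP.
by have := Quotient.idealrBE (quad_ideal r : idealr _) p q => <-.
Qed.

Lemma quad_ideal_vanish (D : {mpoly K[n]} -> K) :
  (forall c p q, D (c *: p + q) = c * D p + D q) ->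
  (forall c i j, r i j -> D (c * ('X_i * 'X_j)) = 0) ->
  forall p, quad_ideal r p -> D p = 0.
Proof.
move=> DL DX p /asboolP[c ->].
have D0 : D 0 = 0 by have := DL (-1) 0 0; rewrite scaleN1r addNr mulN1r addNr.
have DD p1 p2 : D p1 = 0 -> D p2 = 0 -> D (p1 + p2) = 0.
  by move=> p1_0 p2_0; rewrite -[p1]scale1r DL p1_0 p2_0 mulr0 addr0.
by do 2!apply: (big_ind (fun q => D q = 0)) => // ? ?; apply: DX.
Qed.

Lemma quad_ideal_const p : quad_ideal r p -> const_term p = 0.
Proof.
apply: quad_ideal_vanish => [|c i j _]; first exact: const_term_linear.
by rewrite !const_termM !const_termX !mulr0.
Qed.

Lemma quad_ideal_lin a p : quad_ideal r p -> lin_coef a p = 0.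
Proof.
apply: quad_ideal_vanish => [|c i j _]; first exact: lin_coef_linear.
by rewrite !lin_coefM const_termM !const_termX !(mulr0, mul0r, addr0).
Qed.

(** In [c * ('X_i * 'X_j)] the mixed coefficient is the constant term of [c] times
    the number of ways to match [i, j] with [a, b]; there are none as [r i j]
    holds and [r a b] fails. *)
Lemma quad_ideal_mixed a b p : ~~ r a b -> quad_ideal r p -> mixed_coef a b p = 0.
Proof.
move=> rab; apply: quad_ideal_vanish => [|c i j rij].
  exact: mixed_coef_linear.
rewrite !mixed_coefM !lin_coefM const_termM !const_termX !lin_coefX.
rewrite !(mulr0, mul0r, addr0, add0r) -!natrM !mulnb.
have /negPf-> : ~~ ((i == a) && (j == b)).
  by apply: contra rab => /andP[/eqP<- /eqP<-].
have /negPf-> : ~~ ((i == b) && (j == a)).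
  by apply: contra rab => /andP[/eqP<- /eqP<-]; rewrite r_sym.
by rewrite addr0 mulr0.
Qed.

Lemma lin_coef_pi a p q :
  \pi_(quad_ring K r) p = \pi_(quad_ring K r) q -> lin_coef a p = lin_coef a q.
Proof.
move/pi_quad_eq/(quad_ideal_lin a).
rewrite addrC -scaleN1r lin_coef_linear mulN1r addrC => /eqP.
by rewrite subr_eq0 => /eqP.
Qed.

Lemma const_term_pi p q :
  \pi_(quad_ring K r) p = \pi_(quad_ring K r) q -> const_term p = const_term q.
Proof.
move/pi_quad_eq/quad_ideal_const.
rewrite addrC -scaleN1r const_term_linear mulN1r addrC => /eqP.
by rewrite subr_eq0 => /eqP.
Qed.

Lemma pi_quad_prod0 i j : r i j ->
  \pi_(quad_ring K r) 'X_i * \pi_(quad_ring K r) 'X_j = 0.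
Proof.
move=> rij; rewrite -rmorphM -(rmorph0 (\pi_(quad_ring K r))).
apply/pi_quad_eq; rewrite subr0; apply/asboolP.
exists (fun k l => ((k == i) && (l == j))%:R).
rewrite (bigD1 i) //= (bigD1 j) //= !eqxx mul1r big1 => [|l /andP[_ /negPf->]].
  rewrite addr0 big1 ?addr0 // => k /negPf ki.
  by rewrite big1 // => l _; rewrite ki mul0r.
by rewrite andbF mul0r.
Qed.

End QuadRingJets.

(** * The linear part of an algebra morphism *)

Section Jacobian.
Variables (K : fieldType) (n m : nat) (r : rel 'I_n) (s : rel 'I_m).
Hypotheses (r_refl : reflexive r) (s_sym : ssrbool.symmetric s).
Variable f : {lrmorphism quad_ring K r -> quad_ring K s}.

(** An arbitrary representative of the image; only its coefficients that do not
    depend on the choice are used. *)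
Definition img_poly p : {mpoly K[m]} := repr (f (\pi p)).

Definition jacobian : 'M[K]_(n, m) := \matrix_(i, a) lin_coef a (img_poly 'X_i).

Lemma pi_img_poly p : \pi_(quad_ring K s) (img_poly p) = f (\pi p).
Proof. exact: reprK. Qed.

Lemma pi_img_poly1 : \pi_(quad_ring K s) (img_poly 1) = \pi_(quad_ring K s) 1.
Proof. by rewrite pi_img_poly !rmorph1. Qed.

Lemma pi_img_poly_linear c p q :
  \pi_(quad_ring K s) (img_poly (c *: p + q)) =
    \pi_(quad_ring K s) (c *: img_poly p + img_poly q).
Proof.
rewrite pi_img_poly !rmorphD /= pi_img_poly -2!pi_quad_scale pi_img_poly.
by congr (_ + _); apply: linearZ.
Qed.

Lemma pi_img_polyM p q :
  \pi_(quad_ring K s) (img_poly (p * q)) =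
    \pi_(quad_ring K s) (img_poly p * img_poly q).
Proof. by rewrite pi_img_poly !rmorphM /= !pi_img_poly. Qed.

Lemma quad_ideal_img i j : r i j -> quad_ideal s (img_poly 'X_i * img_poly 'X_j).
Proof.
move=> rij; rewrite -[_ * _]subr0; apply/pi_quad_eq.
by rewrite rmorphM /= !pi_img_poly -rmorphM pi_quad_prod0 // !rmorph0.
Qed.

(** The square of the image vanishes, and so does the square of its constant
    term. *)
Lemma const_term_imgX i : const_term (img_poly 'X_i) = 0.
Proof.
have /quad_ideal_const := quad_ideal_img (r_refl i).
by rewrite const_termM => /eqP; rewrite mulf_eq0 orbb => /eqP.
Qed.

Lemma const_term_img p : const_term (img_poly p) = const_term p.
Proof.
elim/mpoly_gen_ind: p => [|i|c p1 p2 IH1 IH2|p1 p2 IH1 IH2].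
- by rewrite (const_term_pi pi_img_poly1) /const_term !meval1.
- by rewrite const_term_imgX const_termX.
- by rewrite (const_term_pi (pi_img_poly_linear c p1 p2)) !const_term_linear IH1 IH2.
by rewrite (const_term_pi (pi_img_polyM p1 p2)) !const_termM IH1 IH2.
Qed.

(** The map that sends [p] to the linear coefficient of its image is a point
    derivation at the origin, since images keep their constant terms. *)
Lemma lin_coef_img a p :
  lin_coef a (img_poly p) = \sum_i lin_coef i p * jacobian i a.
Proof.
transitivity (\sum_i lin_coef i p * lin_coef a (img_poly 'X_i)); last first.
  by apply: eq_bigr => i _; rewrite mxE.
apply: (lin_functional_expand (D := fun p => lin_coef a (img_poly p)))
  => [c p1 p2|p1 p2].
  by rewrite (lin_coef_pi _ (pi_img_poly_linear c p1 p2)) lin_coef_linear.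
by rewrite (lin_coef_pi _ (pi_img_polyM p1 p2)) lin_coefM !const_term_img.
Qed.

Lemma jacobian_rel i j a b : r i j -> ~~ s a b ->
  jacobian i a * jacobian j b + jacobian i b * jacobian j a = 0.
Proof.
move=> rij sab; rewrite !mxE.
have := quad_ideal_mixed s_sym sab (quad_ideal_img rij).
by rewrite mixed_coefM !const_term_imgX mulr0 mul0r addr0 add0r.
Qed.

End Jacobian.

Lemma jacobian_inv (K : fieldType) n m (r : rel 'I_n) (s : rel 'I_m)
    (f : {lrmorphism quad_ring K r -> quad_ring K s})
    (g : {lrmorphism quad_ring K s -> quad_ring K r}) :
  reflexive s -> cancel f g ->
  jacobian f *m jacobian g = 1%:M.
Proof.
move=> s_refl fK; apply/matrixP=> i j; rewrite !mxE.
transitivity (lin_coef j (img_poly g (img_poly f 'X_i))).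
  by rewrite lin_coef_img //; apply: eq_bigr => a _; rewrite !mxE.
by rewrite (lin_coef_pi (r := r) j (q := 'X_i)) ?lin_coefX // !pi_img_poly fK.
Qed.

(** Otherwise every term of the Leibniz expansion vanishes. *)
Lemma det_neq0_transversal (K : fieldType) n (M : 'M[K]_n) :
  \det M != 0 -> exists s : 'S_n, forall i, M i (s i) != 0.
Proof.
move=> detM; apply: contrapT => noS; case/eqP: detM.
rewrite /determinant big1 // => s _.
have [i Mi0] : exists i, M i (s i) = 0.
  apply: contrapT => noi; apply: noS; exists s => i.
  by apply/eqP => Mi; apply: noi; exists i.
by rewrite (bigD1 i) //= Mi0 mul0r mulr0.
Qed.

(** The relation for [i, i] makes row [i] of the Jacobian vanish at [t j], so that
    only the product of two nonzero entries is left of the relation for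
    [i, j]. *)
Lemma transversal_rel (K : fieldType) n (r s : rel 'I_n) (t : 'S_n)
    (f : {lrmorphism quad_ring K r -> quad_ring K s}) :
  2%:R != 0 :> K -> reflexive r -> ssrbool.symmetric s ->
  (forall i, jacobian f i (t i) != 0) -> forall i j, r i j -> s (t i) (t j).
Proof.
move=> two_neq0 r_refl s_sym f_t i j rij; apply: contraT => nst.
have := jacobian_rel r_refl s_sym f (r_refl i) nst.
rewrite [X in _ + X]mulrC -mulr2n -mulr_natl.
move/eqP; rewrite !mulf_eq0 (negPf two_neq0) (negPf (f_t i)) /= => /eqP Mij.
have := jacobian_rel r_refl s_sym f rij nst.
move/eqP; rewrite Mij mul0r addr0 mulf_eq0.
by rewrite (negPf (f_t i)) (negPf (f_t j)).
Qed.

(** Both relations have the same number of pairs, since each embeds in the other;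
    so the embedding of the first in the second is onto. *)
Lemma rel_embedding_iso n (r s : rel 'I_n) (t u : 'S_n) :
  (forall i j, r i j -> s (t i) (t j)) -> (forall i j, s i j -> r (u i) (u j)) ->
  forall i j, s (t i) (t j) = r i j.
Proof.
pose gr (q : rel 'I_n) := [set p | q p.1 p.2].
pose act (v : 'S_n) (p : 'I_n * 'I_n) := (v p.1, v p.2).
have act_inj v : injective (act v).
  by case=> a b [c d] [] /perm_inj-> /perm_inj->.
have sub (q q' : rel 'I_n) (v : 'S_n) : (forall i j, q i j -> q' (v i) (v j)) ->
    act v @: gr q \subset gr q'.
  by move=> qq'; apply/subsetP=> _ /imsetP[[a b] + ->]; rewrite !inE => /qq'.
move=> rs sr i j; apply/idP/idP => [|/rs//].
have := sub _ _ _ rs; have /subset_leq_card := sub _ _ _ sr.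
rewrite card_imset // => le_sr /subset_leqif_cards[].
rewrite card_imset // => le_rs /esym; rewrite eqn_leq le_rs le_sr => /eqP tE stij.
have : (t i, t j) \in gr s by rewrite inE.
by rewrite -tE -[(t i, t j)]/(act t (i, j)) mem_imset // inE.
Qed.

Lemma lrmorphism_inv (K : fieldType) (A B : comAlgType K)
    (f : {lrmorphism A -> B}) (g0 : B -> A) :
  cancel f g0 -> cancel g0 f ->
  exists2 g : {lrmorphism B -> A}, cancel f g & cancel g f.
Proof.
move=> fK gK.
pose gL := GRing.isLinear.Build K B A _ g0 (can2_linear fK gK).
pose gM := GRing.isMonoidMorphism.Build B A g0 (can2_monoid_morphism fK gK).
pose g : {lrmorphism B -> A} := HB.pack g0 gL gM.
by exists g.
Qed.

(** * Recovering the graph from the ring *)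

Theorem quad_ring_iso_rel (K : fieldType) n m (r : rel 'I_n) (s : rel 'I_m) :
  2%:R != 0 :> K -> reflexive r -> ssrbool.symmetric r ->
  reflexive s -> ssrbool.symmetric s ->
  alg_iso (quad_ring K r) (quad_ring K s) ->
  exists2 t : 'I_n -> 'I_m, bijective t & {mono t : i j / r i j >-> s i j}.
Proof.
move=> two_neq0 r_refl r_sym s_refl s_sym [f [g0 fg gf]].
have [g fK gK] := lrmorphism_inv fg gf.
have fg1 := jacobian_inv s_refl fK; have gf1 := jacobian_inv r_refl gK.
have nm : n = m.
  by apply/eqP; rewrite eqn_leq (mulmx1_min fg1) (mulmx1_min gf1).
move: nm => nm; subst m.
have [t tP] : exists t : 'S_n, forall i, jacobian f i (t i) != 0.
  apply: det_neq0_transversal; rewrite -unitfE -unitmxE.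
  by have [] := mulmx1_unit fg1.
have [u uP] : exists u : 'S_n, forall i, jacobian g i (u i) != 0.
  apply: det_neq0_transversal; rewrite -unitfE -unitmxE.
  by have [] := mulmx1_unit gf1.
exists t; first exact: injF_bij perm_inj.
move=> i j /=; apply: (rel_embedding_iso (u := u)).
  exact: (transversal_rel (f := f)).
exact: (transversal_rel (f := g)).
Qed.

Lemma edges_meet_refl G : reflexive (@edges_meet G).
Proof.
move=> i; rewrite /edges_meet -/(meet _ _).
have [x [y [_ e_xy]]] := edgesP _ (enum_valP i).
by apply/meetP; exists x; rewrite e_xy set21.
Qed.

Lemma edges_meet_sym G : ssrbool.symmetric (@edges_meet G).
Proof. by move=> i j; rewrite /edges_meet disjoint_sym. Qed.

Lemma local_ring_line_iso (K : fieldType) G H : 2%:R != 0 :> K ->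
  alg_iso (full_local_ring K G) (full_local_ring K H) ->
  exists sg tu, @line_iso G H sg tu.
Proof.
move=> two_neq0 /(quad_ring_iso_rel two_neq0 (@edges_meet_refl G)
  (@edges_meet_sym G) (@edges_meet_refl H) (@edges_meet_sym H))[t t_bij t_mono].
exact: edges_meet_line_iso t_bij t_mono.
Qed.

Lemma three_meeting_edges_R3 (K : fieldType) G :
  three_meeting_edges G -> alg_iso (full_local_ring K G) (R3 K).
Proof.
case=> E3 Emeet; rewrite /full_local_ring /R3.
have : @edges_meet G =2 fun _ _ => true.
  by move=> i j; apply: Emeet; apply: enum_valP.
move: (@edges_meet G); rewrite E3 => r rT.
have -> : r = fun _ _ => true by apply/funext=> i; apply/funext=> j; apply: rT.
by exists idfun; exists id.
Qed.

Theorem theorem7 (K : fieldType) (charK : [pchar K] =i pred0) :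
  [/\ forall G G' : sgraph, connected G -> connected G' ->
        ~ alg_iso (full_local_ring K G) (R3 K) ->
        alg_iso (full_local_ring K G) (full_local_ring K G') ->
        graph_iso G G',
      forall G G' : sgraph, connected G -> connected G' ->
        alg_iso (full_local_ring K G) (full_local_ring K G') ->
        [\/ graph_iso G G',
            graph_iso G triangle /\ graph_iso G' star3
          | graph_iso G star3 /\ graph_iso G' triangle],
      alg_iso (full_local_ring K triangle) (R3 K)
    & alg_iso (full_local_ring K star3) (R3 K)].
Proof.
have two_neq0 : 2%:R != 0 :> K by have := charK 2; rewrite !inE /= => ->.
have main (G G' : sgraph) : connected G -> connected G' ->
    alg_iso (full_local_ring K G) (full_local_ring K G') ->
    [\/ graph_iso G G', graph_iso G triangle /\ graph_iso G' star3
      | graph_iso G star3 /\ graph_iso G' triangle].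
  move=> conG conG' /(local_ring_line_iso two_neq0)[sg [tu st]].
  exact: whitney conG conG' st.
split=> //.
- move=> G G' conG conG' nR3 /(main _ _ conG conG')[//|[Gt _]|[Gs _]]; case: nR3.
    apply: three_meeting_edges_R3.
    exact: three_meeting_edges_iso Gt three_meeting_edges_triangle.
  apply: three_meeting_edges_R3.
  exact: three_meeting_edges_iso Gs three_meeting_edges_star3.
- exact: three_meeting_edges_R3 three_meeting_edges_triangle.
exact: three_meeting_edges_R3 three_meeting_edges_star3.
Qed.
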